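(* Let $H(\Delta)$ be the entropy-distortion function of the sawbridge. If $\Delta\ge 1/6$, then $H(\Delta)=0$. For every $0<\Delta<1/6$, $$H(\Delta) = -\left\lfloor \tfrac{1}{p}\right\rfloor p\log p - q\log q,$$ where $q = 1 - \lfloor 1/p\rfloor\, p$ and $p$ is the unique number in $(0,1)$ such that $$\left\lfloor \tfrac{1}{p}\right\rfloor p^2 + q^2 = 6\Delta.$$
   Context: Let $U$ be uniformly distributed on $[0,1]$. The sawbridge is the random process $X(t) = t - \mathbf{1}(t\ge U)$, $t\in[0,1]$, viewed as a random element of $L^2[0,1]$. An encoder is a (measurable) map $f:L^2[0,1]\to\mathbb{N}$. Its entropy and distortion are $$H(f) = -\sum_{i\in\mathbb{N}} P(f(X)=i)\log P(f(X)=i),\qquad D(f) = E\Big[\int_0^1 \big(X(t)-E[X(t)\mid f(X)]\big)^2\,dt\Big].$$ All logarithms are base 2 (with $0\log 0=0$). The entropy-distortion function is $H(\Delta) = \inf\{H(f): f \text{ an encoder with } D(f)\le\Delta\}$. *)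

(* Defs.v *)
From mathcomp Require Import all_boot all_order all_algebra.
From mathcomp Require Import all_classical all_reals all_analysis.
Set Implicit Arguments. Unset Strict Implicit. Unset Printing Implicit Defensive.
Import Order.TTheory GRing.Theory Num.Theory.
Import numFieldNormedType.Exports.
Local Open Scope classical_set_scope.
Local Open Scope ring_scope.

Section Sawbridge.
Variable R : realType.
Local Notation mu := (@lebesgue_measure R).

(* Sample path of the sawbridge for the value u of U:  t |-> t - 1(t >= u).
   A path is represented as a function R -> R (only its values on [0,1]
   matter).  U is uniform on [0,1], i.e. its law is Lebesgue measure
   restricted to [0,1]. *)
Definition sawpath (u : R) : R -> R := fun t => t - (if u <= t then 1 else 0).

(* an encoder f maps paths to nat; measurability = f(X) is a random variable *)
Definition encoder (f : (R -> R) -> nat) : Prop :=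
  forall i : nat, measurable (`[0%R, 1%R]%classic `&` [set u | f (sawpath u) = i]).

Definition cell (f : (R -> R) -> nat) (i : nat) : set R :=
  `[0%R, 1%R]%classic `&` [set u | f (sawpath u) = i].

Definition cellprob (f : (R -> R) -> nat) (i : nat) : R := fine (mu (cell f i)).

Definition xlog2 (x : R) : R := if x == 0 then 0 else x * (ln x / ln 2).

Definition entropy (f : (R -> R) -> nat) : \bar R :=
  (\sum_(0 <= i <oo) (- xlog2 (cellprob f i))%:E)%E.

(* E[X(t) | f(X) = i]  (discrete conditioning; value 0 on null cells, irrelevant) *)
Definition condmean (f : (R -> R) -> nat) (i : nat) (t : R) : R :=
  Rintegral mu (cell f i) (fun u => sawpath u t) / cellprob f i.

Definition distortion (f : (R -> R) -> nat) : \bar R :=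
  (\int[mu]_(u in `[0%R, 1%R]%classic)
     \int[mu]_(t in `[0%R, 1%R]%classic)
        ((sawpath u t - condmean f (f (sawpath u)) t) ^+ 2)%:E)%E.

Definition entropy_distortion (D : R) : \bar R :=
  ereal_inf [set entropy f | f in [set f | encoder f /\ (distortion f <= D%:E)%E]].

End Sawbridge.

(* Main.v *)
Require Import Defs.
From mathcomp Require Import all_boot all_order all_algebra.
From mathcomp Require Import all_classical all_reals all_analysis.
From mathcomp Require Import measurable_realfun ring lra.
Set Implicit Arguments. Unset Strict Implicit. Unset Printing Implicit Defensive.
Import Order.TTheory GRing.Theory Num.Theory.
Import numFieldNormedType.Exports.
Local Open Scope classical_set_scope.
Local Open Scope ring_scope.

(* Let C_i be the set of u in [0,1] encoded by i, let p_i be its measure, and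
   put F_i(t) = mu(C_i /\ [0,t]).  By Tonelli the distortion is the sum over i
   of the integrals of F_i (p_i - F_i) / p_i.  As F_i is 1-Lipschitz and equals
   p_i/2 at some point, the i-th integral is at least p_i^2/6, with equality
   when C_i is an interval.  The problem thus becomes to minimise the entropy
   of (p_i) under the constraint sum p_i^2 <= 6 D.

   For the latter, put g_c(x) = 2 c x - x^2 for x <= c and g_c(x) = c^2 beyond.
   Then - x ln x + x^2/2 is the integral of g_c(x) / (2 c^2) over c in (0,1], so
   it suffices that, for each single c, the sum of the g_c(p_i) is minimal at
   the distribution (p, ..., p, q). *)

(** * Truncated parabolas: the inequality for a single c and finitely many masses *)

Section Truncated.
Variable R : realFieldType.
Implicit Types (c p q x y s : R) (xs ys : seq R).

Definition qtrunc c x : R := if x <= c then 2 * c * x - x ^+ 2 else c ^+ 2.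

Lemma qtrunc_ge_quad c x : 2 * c * x - x ^+ 2 <= qtrunc c x.
Proof. by rewrite /qtrunc; case: ifP => // _; have := sqr_ge0 (c - x); nra. Qed.

Lemma qtrunc_ge0 c x : 0 <= x -> 0 <= qtrunc c x.
Proof. by rewrite /qtrunc; case: ifP => [xc x0|_ _]; [nra|exact: sqr_ge0]. Qed.

Lemma qtrunc_min c x : qtrunc c x = qtrunc c (Num.min x c).
Proof.
rewrite /qtrunc; case: (leP x c) => xc; first by rewrite xc.
by rewrite lexx; ring.
Qed.

(* The greedy allocation (m copies of c and a remainder q) minimises a sum of
   concave terms on [0, c] with prescribed total. *)
Lemma sum_concave_ge c ys (m : nat) q :
  (forall y, y \in ys -> 0 <= y <= c) -> 0 <= q <= c ->
  m%:R * c + q <= \sum_(y <- ys) y ->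
  m%:R * c ^+ 2 + (2 * c * q - q ^+ 2) <= \sum_(y <- ys) (2 * c * y - y ^+ 2).
Proof.
elim: ys m q => [|y ys IH] m q ysc qc.
  rewrite !big_nil => h.
  have m0 : 0 <= m%:R * c by apply: mulr_ge0 => //; lra.
  have q0 : q = 0 by lra.
  have mc : m%:R * c = 0 by lra.
  by rewrite q0 expr2 mulrA mc; lra.
rewrite !big_cons => h.
have /andP[y0 yc] : 0 <= y <= c by apply: ysc; rewrite mem_head.
have {}ysc z : z \in ys -> 0 <= z <= c by move=> zys; apply: ysc; rewrite in_cons zys orbT.
(* If y <= q, y is taken out of the remainder, and subadditivity of 2 c y - y^2 suffices. Otherwise
   one copy of c is opened: q + c - y is the new remainder, and concavity compares the pair (q, c)
   with the less spread pair (y, q + c - y). Without a copy left, monotonicity on [0, c] is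
   enough. *)
case: (lerP y q) => yq.
  have := IH m (q - y) ysc => /(_ ltac:(lra) ltac:(lra)).
  by nra.
case: m h => [|m] h.
  have : 0 <= \sum_(y <- ys) (2 * c * y - y ^+ 2).
    by rewrite big_seq; apply: sumr_ge0 => z /ysc; nra.
  by nra.
rewrite -natr1 in h *.
have := IH m (q + c - y) ysc => /(_ ltac:(lra) ltac:(lra)).
by nra.
Qed.

(** The list is a finite part of a distribution; the term 2 (1 - S), with S its total, pays for the
    missing mass and vanishes in the limit. *)
Lemma sum_qtrunc_ge_finite (n : nat) p q c xs :
  (forall x, x \in xs -> 0 <= x) ->
  0 <= q <= p -> n%:R * p + q = 1 -> 0 < c <= 1 ->
  \sum_(x <- xs) x <= 1 ->
  (c < p -> n%:R * c + Num.min q c <= \sum_(x <- xs) x) ->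
  \sum_(x <- xs) x ^+ 2 <= n%:R * p ^+ 2 + q ^+ 2 ->
  n%:R * qtrunc c p + qtrunc c q - 2 * (1 - \sum_(x <- xs) x)
    <= \sum_(x <- xs) qtrunc c x.
Proof.
move=> xs0 /andP[q0 qp] npq /andP[c0 c1] S1 Sc S2.
set S := \sum_(x <- xs) x in S1 Sc *.
(* For p <= c the left side consists of untruncated parabolas, whose sum depends only on the total
   and on the sum of squares. *)
case: (lerP p c) => pc.
  rewrite /qtrunc pc (le_trans qp pc) -/(qtrunc c).
  apply: (@le_trans _ _ (\sum_(x <- xs) (2 * c * x - x ^+ 2))).
    by rewrite sumrB -mulr_sumr -/S; nra.
  by apply: ler_sum => x _; exact: qtrunc_ge_quad.
have {}Sc := Sc pc.
have -> : qtrunc c p = c ^+ 2 by rewrite /qtrunc leNgt pc.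
rewrite (qtrunc_min c q); set q' := Num.min q c in Sc *.
have q'c : 0 <= q' <= c by rewrite /q' le_min q0 (ltW c0) ge_min lexx orbT.
have q'q : q' <= q by rewrite /q' ge_min lexx.
have q'E : q' = q \/ q' = c by rewrite /q'; case: (leP q c); [left|right].
clearbody q'.
rewrite {1}/qtrunc; case/andP: (q'c) => q'0 ->.
have splitS (f : R -> R) : \sum_(x <- xs) f x =
    \sum_(x <- xs | ~~ (x <= c)) f x + \sum_(x <- xs | x <= c) f x.
  by rewrite (bigID (fun x => x <= c)) /= addrC.
set k := count (fun x => ~~ (x <= c)) xs.
have bigg : \sum_(x <- xs | ~~ (x <= c)) qtrunc c x = k%:R * c ^+ 2.
  rewrite (eq_bigr (fun=> c ^+ 2)); last by move=> x /negbTE h; rewrite /qtrunc h.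
  by rewrite big_const_seq iter_addr_0 mulr_natl.
have smallg : \sum_(x <- xs | x <= c) qtrunc c x =
   \sum_(x <- xs | x <= c) (2 * c * x - x ^+ 2).
  by apply: eq_bigr => x h; rewrite /qtrunc h.
have small0 : 0 <= \sum_(x <- xs | x <= c) qtrunc c x.
  by rewrite big_seq_cond; apply: sumr_ge0 => x /andP[/xs0 x0 _]; exact: qtrunc_ge0.
rewrite splitS bigg.
(* More than n terms above c already give (n + 1) c^2, and the remainder q' is worth at most c^2.
   Otherwise the k large terms match k of the n copies, and the small terms have to match the other
   m = n - k copies and q'. *)
have [nk|kn] := ltnP n k.
  have : n%:R + 1 <= k%:R :> R by rewrite natr1 ler_nat.
  by nra.
pose m := (n - k)%N.
have nE : n%:R = m%:R + k%:R :> R by rewrite -natrD subnK.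
rewrite smallg.
case: (lerP (m%:R * c + q') (\sum_(x <- xs | x <= c) x)) => rm.
  have := @sum_concave_ge c [seq x <- xs | x <= c] m q'.
  rewrite !big_filter => /(_ _ q'c rm) H.
  have {}H := H ltac:(by move=> x; rewrite mem_filter => /andP[-> /xs0 ->]).
  by rewrite nE; lra.
(* If no term exceeded c, the small terms would carry all of S, which is at least n c + q' by [Sc],
   against [rm]. *)
have k0 : (0 < k)%N.
  rewrite lt0n; apply/eqP => k0; have mn : m = n by rewrite /m k0 subn0.
  move: rm; rewrite mn ltNge => /negP; apply.
  apply: (le_trans Sc); rewrite /S splitS /=.
  rewrite [X in X + _]big_hasC ?add0r//.
  by rewrite has_count -/k k0.
have k0r : 1 <= k%:R :> R by rewrite (ler_nat _ 1).
have m0r : 0 <= m%:R :> R by [].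
(* l is the common value of the k terms above c when the others total m c + q';
   the tangent of the square at l bounds the sum of squares of those k terms. *)
pose l := (1 - q' - m%:R * c) / k%:R.
have kl : k%:R * l = 1 - q' - m%:R * c by rewrite /l mulrC mulfVK//; lra.
have lc : c <= l.
  have : k%:R * c <= k%:R * l by rewrite kl; nra.
  by rewrite ler_pM2l//; lra.
have l1 : l <= 1.
  have : l <= k%:R * l by nra.
  by rewrite kl; nra.
have H1 : 2 * l * \sum_(x <- xs | ~~ (x <= c)) x - k%:R * l ^+ 2
   <= \sum_(x <- xs | ~~ (x <= c)) x ^+ 2.
  have -> : k%:R * l ^+ 2 = \sum_(x <- xs | ~~ (x <= c)) l ^+ 2.
    by rewrite big_const_seq iter_addr_0 mulr_natl.
  rewrite mulr_sumr -sumrB; apply: ler_sum => x _.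
  by have := sqr_ge0 (x - l); nra.
rewrite sumrB -mulr_sumr.
have SE : S = \sum_(x <- xs | ~~ (x <= c)) x + \sum_(x <- xs | x <= c) x.
  exact: splitS.
rewrite splitS in S2.
move: S2 SE rm H1.
set r := \sum_(x <- xs | x <= c) x; set A := \sum_(x <- xs | ~~ _) x.
set A2 := \sum_(x <- xs | ~~ _) _; set r2 := \sum_(x <- xs | _) _.
move=> S2 SE rm H1.
(* Both sides are sums of n + 1 squares whose bases add up to 1. The tangent of the square at p
   bounds the m entries c and the k entries l from below; the change from q to q' is covered by q +
   q' <= 2 p. *)
have key : n%:R * p ^+ 2 + q ^+ 2 <= m%:R * c ^+ 2 + q' ^+ 2 + k%:R * l ^+ 2.
  have T x : 2 * p * x - p ^+ 2 <= x ^+ 2 by have := sqr_ge0 (x - p); nra.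
  have Tc : m%:R * (2 * p * c - p ^+ 2) <= m%:R * c ^+ 2 by rewrite ler_wpM2l.
  have Tl : k%:R * (2 * p * l - p ^+ 2) <= k%:R * l ^+ 2.
    by rewrite ler_wpM2l//; lra.
  have : 2 * p * (m%:R * c + k%:R * l) - n%:R * p ^+ 2
      <= m%:R * c ^+ 2 + k%:R * l ^+ 2 by rewrite nE; lra.
  rewrite kl; have -> : m%:R * c + (1 - q' - m%:R * c) = 1 - q' by ring.
  rewrite -npq.
  case: q'E => [->|q'E]; first by nra.
  have : 0 <= (q - q') * (2 * p - q - q') by apply: mulr_ge0; lra.
  by nra.
(* The small terms give 2 c r - r2. Bounding r2 through [S2], [key] and [H1], with A = S - r, leaves
   r with the coefficient 2 (c - l) <= 0, so r may be raised to m c + q'. The result is the greedy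
   value minus 2 l (1 - S), and l <= 1. *)
have rr : (l - c) * r <= (l - c) * (m%:R * c + q') by apply: ler_wpM2l; lra.
have lS : l * (1 - S) <= 1 - S by nra.
have lkl : l * (k%:R * l) = l * (1 - q' - m%:R * c) by rewrite kl.
have lSE : l * S = l * (A + r) by rewrite SE.
rewrite nE in S2 key *.
lra.
Qed.
End Truncated.

(** * The integral representation of x^2/2 - x ln x *)

Section Kernel.
Variable R : realType.
Local Notation mu := (@lebesgue_measure R).

Lemma integral_derive (F f : R -> R) (a b : R) : a <= b ->
  (forall x : R, x \in `[a, b] -> is_derive x 1 F (f x)) ->
  (forall x : R, x \in `[a, b] -> {for x, continuous f}) ->
  (\int[mu]_(x in `[a, b]) (f x)%:E = (F b - F a)%:E)%E.
Proof.
rewrite le_eqVlt => /predU1P[<- _ _|ab dF cf].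
  by rewrite set_itv1 integral_set1 subrr.
have dFx x : x \in `[a, b] -> derivable F x 1.
  by move=> /dF dx; exact: ex_derive.
have cF x : x \in `[a, b] -> {for x, continuous F}.
  by move=> /dFx dx; apply/differentiable_continuous; rewrite -derivable1_diffP.
have oc x : x \in `]a, b[ -> x \in `[a, b] by exact: subset_itv_oo_cc.
rewrite EFinB; apply: continuous_FTC2 => //.
- apply: continuous_in_subspaceT => x; rewrite inE => xab; exact: cf.
- split.
  + by move=> x /oc; exact: dFx.
  + apply: cvg_at_right_filter; apply: cF; by rewrite in_itv/= lexx ltW.
  + apply: cvg_at_left_filter; apply: cF; by rewrite in_itv/= lexx ltW.
- by move=> x /oc /dF dx; rewrite derive1E; exact: derive_val.
Qed.

Lemma measurable_fun_qtrunc (x : R) :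
  measurable_fun (`]0, 1] : set R) (fun c : R => qtrunc c x / (2 * c ^+ 2)).
Proof.
have mpos : measurable_fun (`]0, +oo[ : set R) (fun c : R => (2 * c ^+ 2)^-1).
  apply: open_continuous_measurable_fun; first exact: interval_open.
  move=> c; rewrite inE/= in_itv/= andbT => c0.
  apply: cvgV; first by rewrite mulf_neq0 ?expf_neq0 ?gt_eqF.
  by apply: cvgM; [exact: cvg_cst|apply: exprn_continuous].
apply: measurable_funM; last first.
  apply: measurable_funS mpos => // c /=; rewrite !in_itv/= andbT.
  by case/andP.
apply: (@measurable_funS _ _ _ _ setT) => //.
rewrite /qtrunc; apply: measurable_fun_ifT => //.
- exact: measurable_fun_ler.
- apply: measurable_funB => //; apply: measurable_funM => //.
Qed.

(** Split at c = x: below, the integrand is the constant 1/2; above, it is x/c - x^2/(2 c^2), with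
    primitive x ln c + x^2/(2 c). *)
Lemma integral_qtrunc (x : R) : 0 <= x <= 1 ->
  (\int[mu]_(c in `]0%R, 1%R]) (qtrunc c x / (2 * c ^+ 2))%:E
     = (x ^+ 2 / 2 - x * ln x)%:E)%E.
Proof.
move=> /andP[x0 x1]; move: x0; rewrite le_eqVlt => /predU1P[<-|x0].
  rewrite expr0n/= mul0r mul0r subrr.
  apply: integral0_eq => c; rewrite /= in_itv/= => /andP[c0 _].
  by rewrite /qtrunc (ltW c0) mulr0 expr0n/= subrr mul0r.
rewrite (@itv_bndbnd_setU _ _ _ (BRight x)); last 2 first.
  by rewrite bnd_simp ltW.
  by rewrite bnd_simp.
have -> : x ^+ 2 / 2 - x * ln x = x / 2 + (x ^+ 2 / 2 - x * ln x - x / 2) by ring.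
have mk := measurable_fun_qtrunc x.
have k0 c : 0 <= qtrunc c x / (2 * c ^+ 2).
  by rewrite divr_ge0 ?qtrunc_ge0 ?(ltW x0)// mulr_ge0// sqr_ge0.
rewrite ge0_integral_setU//=; last 3 first.
- rewrite -itv_bndbnd_setU ?bnd_simp//; first exact/measurable_EFinP.
  exact: ltW.
- by move=> c _; rewrite lee_fin.
- apply/disj_setPLR => c /=; rewrite !in_itv/= => /andP[_ cx].
  by rewrite ltNge cx.
rewrite EFinD; congr (_ + _)%E.
  rewrite (eq_integral (fun=> (2^-1)%:E)).
    rewrite integral_cst//= lebesgue_measure_itv/= lte_fin x0 -EFinB -EFinM.
    by rewrite subr0 mulrC.
  move=> c; rewrite inE/= in_itv/= => /andP[c0 cx]; congr (_%:E).
  rewrite /qtrunc; case: ifPn => [xc|_].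
    have -> : c = x by apply/eqP; rewrite eq_le cx xc.
    by field; rewrite gt_eqF.
  by field; rewrite gt_eqF.
rewrite integral_itv_obnd_cbnd; last first.
  apply/measurable_EFinP; apply: measurable_funS mk => // c /=.
  by rewrite !in_itv/= => /andP[xc ->]; rewrite (lt_trans x0 xc).
have gt0x c : c \in `[x, 1] -> 0 < c.
  by rewrite in_itv/= => /andP[xc _]; exact: lt_le_trans xc.
transitivity (\int[mu]_(c in `[x, 1%R]) (x * c^-1 - x ^+ 2 / 2 * (c ^- 2))%:E)%E.
  apply: eq_integral => c; rewrite inE/= => cx; have c0 := gt0x _ cx.
  move: cx; rewrite in_itv/= => /andP[xc _].
  by congr (_%:E); rewrite /qtrunc xc; field; rewrite gt_eqF.
pose F (c : R) := x * ln c + x ^+ 2 / 2 * c^-1.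
apply: etrans (@integral_derive F _ x 1 x1 _ _) _.
- move=> c /gt0x c0.
  have dl := is_derive1_ln c0.
  have cn0 : c != 0 by rewrite gt_eqF.
  have dv := is_deriveV cn0 (is_derive_id c 1).
  apply: is_derive_eq.
  by rewrite /= /GRing.scale/=; field.
- move=> c /gt0x c0; apply: cvgB; apply: cvgM; try exact: cvg_cst.
    by apply: cvgV; [rewrite gt_eqF|].
  apply: cvgV; first by rewrite expf_neq0// gt_eqF.
  exact: exprn_continuous.
- by congr (_%:E); rewrite /F ln1 invr1; field; rewrite gt_eqF.
Qed.

End Kernel.

(** * Minimal entropy of a countable distribution under a bound on its sum of squares *)

Section Entropy.
Variable R : realType.
Local Notation mu := (@lebesgue_measure R).

Lemma nneseries_gt (u : nat -> \bar R) (y : \bar R) :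
  (forall i, 0 <= u i)%E -> (y < \sum_(0 <= i <oo) u i)%E ->
  exists N, (y < \sum_(0 <= i < N) u i)%E.
Proof.
move=> u0.
have /cvg_lim -> // := ereal_nondecreasing_cvgn
  (ereal_nondecreasing_series (P := xpredT) (N := 0%N) (fun i _ _ => u0 i)).
by move=> /ereal_sup_gt[_ [N _ <-] yN]; exists N.
Qed.

Lemma xlog2E (x : R) : xlog2 x = x * ln x / ln 2.
Proof. by rewrite /xlog2; case: eqP => [->|_]; rewrite ?mul0r// mulrA. Qed.

Lemma xlog2_le0 (x : R) : 0 <= x <= 1 -> xlog2 x <= 0.
Proof.
move=> /andP[x0 x1]; rewrite xlog2E pmulr_lle0 ?invr_gt0 ?ln_gt0 ?ltr1n//.
by rewrite mulr_ge0_le0// ln_le0.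
Qed.

Lemma nneseries_eq1_le1 (x : nat -> R) :
  (forall i, 0 <= x i) -> (\sum_(0 <= i <oo) (x i)%:E = 1)%E ->
  forall i, x i <= 1.
Proof.
move=> x0 x1 i; rewrite -lee_fin -x1.
have xE0 k : (0 <= (x k)%:E)%E by rewrite lee_fin.
apply: le_trans (nneseries_lim_ge i.+1 (fun k _ _ => xE0 k)).
by rewrite big_nat_recr//= leeDr// sume_ge0.
Qed.

(** A partial sum that misses less than e/2 of the total mass loses less than e in
    [sum_qtrunc_ge_finite], and e is arbitrary. *)
Lemma nneseries_qtrunc_ge (x : nat -> R) (n : nat) (p q : R) (c : R) :
  (forall i, 0 <= x i) -> (\sum_(0 <= i <oo) (x i)%:E = 1)%E ->
  (0 < n)%N -> 0 <= q <= p -> n%:R * p + q = 1 ->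
  (\sum_(0 <= i <oo) (x i ^+ 2)%:E <= (n%:R * p ^+ 2 + q ^+ 2)%:E)%E ->
  0 < c <= 1 ->
  ((n%:R * qtrunc c p + qtrunc c q)%:E <= \sum_(0 <= i <oo) (qtrunc c (x i))%:E)%E.
Proof.
move=> x0 x1 n_gt0 /andP[q0 qp] npq x2.
have xE0 i : (0 <= (x i)%:E)%E by rewrite lee_fin.
move=> c01; apply/lee_addgt0Pr => e e0.
(* The mass that the finite inequality requires when c < p. It is strictly below n p + q = 1 because
   n > 0, so some partial sum exceeds it. *)
pose r := if c < p then n%:R * c + Num.min q c else 0.
have n1 : (1 : R) <= n%:R by rewrite (ler_nat _ 1).
have r1 : r < 1.
  rewrite /r; case: (ltP c p) => // cp.
  by rewrite -[ltRHS]npq ltr_leD ?ltr_pM2l ?ltr0n ?ge_min ?lexx.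
have [N] : exists N, ((Num.max r (1 - e / 2))%:E < \sum_(0 <= i < N) (x i)%:E)%E.
  by apply: nneseries_gt => //; rewrite x1 lte_fin gt_max r1/=; lra.
rewrite sumEFin lte_fin gt_max => /andP[rN eN].
have N1 : \sum_(0 <= i < N) x i <= 1.
  by rewrite -lee_fin -sumEFin -x1; exact: nneseries_lim_ge.
have := @sum_qtrunc_ge_finite _ n p q c [seq x i | i <- index_iota 0 N].
rewrite !big_map => /(_ _ _ npq c01 N1) H.
have {}H : n%:R * qtrunc c p + qtrunc c q - 2 * (1 - \sum_(0 <= j < N) x j)
    <= \sum_(0 <= j < N) qtrunc c (x j).
  apply: H.
  - by move=> _ /mapP[i _ ->].
  - by rewrite q0.
  - by move=> cp; move: rN; rewrite /r cp; exact: ltW.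
  - rewrite -lee_fin -sumEFin (le_trans _ x2)//.
    by apply: nneseries_lim_ge => i _ _; rewrite lee_fin sqr_ge0.
apply: (@le_trans _ _ ((\sum_(0 <= j < N) qtrunc c (x j))%:E + e%:E)%E).
  by rewrite -EFinD lee_fin; lra.
rewrite leeD2r// -sumEFin; apply: nneseries_lim_ge => i _ _.
by rewrite lee_fin qtrunc_ge0.
Qed.

Lemma qtrunc_kernel_ge0 (c y : R) : 0 <= y -> 0 <= qtrunc c y / (2 * c ^+ 2).
Proof. by move=> y0; rewrite divr_ge0 ?qtrunc_ge0// mulr_ge0// sqr_ge0. Qed.

Let phi (y : R) : R := y ^+ 2 / 2 - y * ln y.

(** Integrate the inequality for single c against 1/(2 c^2) over (0, 1]; all terms are nonnegative,
    so series and integral commute. *)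
Let phi_series (x : nat -> R) (n : nat) (p q : R) :
  (forall i, 0 <= x i) -> (\sum_(0 <= i <oo) (x i)%:E = 1)%E ->
  (0 < n)%N -> 0 <= q <= p -> n%:R * p + q = 1 ->
  (\sum_(0 <= i <oo) (x i ^+ 2)%:E <= (n%:R * p ^+ 2 + q ^+ 2)%:E)%E ->
  ((n%:R * phi p + phi q)%:E <= \sum_(0 <= i <oo) (phi (x i))%:E)%E.
Proof.
move=> x0 x1 n_gt0 /andP[q0 qp] npq x2.
have x_le1 := nneseries_eq1_le1 x0 x1.
have n1 : (1 : R) <= n%:R by rewrite (ler_nat _ 1).
have pn : p <= n%:R * p by rewrite ler_peMl//; lra.
have p01 : 0 <= p <= 1 by lra.
have q1 : q <= 1 by lra.
have mK y : measurable_fun (`]0, 1] : set R)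
    (fun c : R => (qtrunc c y / (2 * c ^+ 2))%:E).
  by apply/measurable_EFinP; apply: measurable_fun_qtrunc.
have -> : (n%:R * phi p + phi q)%:E =
  (\int[mu]_(c in `]0%R, 1%R])
     ((n%:R * qtrunc c p + qtrunc c q) / (2 * c ^+ 2))%:E)%E.
  under eq_integral do rewrite mulrDl -mulrA EFinD EFinM.
  rewrite ge0_integralD//; last 4 first.
  - by move=> c _; rewrite -EFinM lee_fin mulr_ge0 ?qtrunc_kernel_ge0//; lra.
  - by apply: measurable_funeM; exact: mK.
  - by move=> c _; rewrite lee_fin qtrunc_kernel_ge0//; lra.
  - exact: mK.
  rewrite integral_qtrunc ?q0// ge0_integralZl//; last 2 first.
  - exact: mK.
  - by move=> c _; rewrite lee_fin qtrunc_kernel_ge0//; lra.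
  by rewrite integral_qtrunc.
under eq_eseriesr => i _.
  rewrite /phi -integral_qtrunc ?x0 ?x_le1//.
  over.
rewrite -integral_nneseries//; last 2 first.
- by move=> i; exact: mK.
- by move=> i c _; rewrite lee_fin qtrunc_kernel_ge0.
apply: ge0_le_integral => //.
- move=> c _; rewrite lee_fin divr_ge0//; last by rewrite mulr_ge0// sqr_ge0.
  by apply: addr_ge0; [apply: mulr_ge0 => //|]; apply: qtrunc_ge0; lra.
- have : measurable_fun (`]0, 1] : set R) (fun c : R =>
      n%:R%:E * (qtrunc c p / (2 * c ^+ 2))%:E + (qtrunc c q / (2 * c ^+ 2))%:E)%E.
    by apply: emeasurable_funD => //; apply: measurable_funeM.
  by apply: eq_measurable_fun => c _; rewrite -EFinM -EFinD mulrA -mulrDl.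
- apply: ge0_emeasurable_sum; last by move=> i _; exact: mK.
  by move=> i c _ _; rewrite lee_fin qtrunc_kernel_ge0.
move=> c /=; rewrite in_itv/= => c01.
have c2 : 0 <= (2 * c ^+ 2)^-1 by rewrite invr_ge0 mulr_ge0// sqr_ge0.
under eq_eseriesr do rewrite mulrC EFinM.
rewrite nneseriesZl//; last by move=> i _; rewrite lee_fin qtrunc_ge0.
rewrite mulrC EFinM lee_wpmul2l// ?lee_fin//.
by apply: nneseries_qtrunc_ge => //; rewrite q0.
Qed.

(** In [phi_series] the quadratic part on the right is at most the one on the left, by the
    constraint on the squares. Cancelling it leaves the inequality for - x ln x, and division by ln
    2 changes the base. *)
Lemma nneseries_xlog2_ge (x : nat -> R) (n : nat) (p q : R) :
  (forall i, 0 <= x i) -> (\sum_(0 <= i <oo) (x i)%:E = 1)%E ->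
  (0 < n)%N -> 0 <= q <= p -> n%:R * p + q = 1 ->
  (\sum_(0 <= i <oo) (x i ^+ 2)%:E <= (n%:R * p ^+ 2 + q ^+ 2)%:E)%E ->
  ((- (n%:R * xlog2 p) - xlog2 q)%:E <= \sum_(0 <= i <oo) (- xlog2 (x i))%:E)%E.
Proof.
move=> x0 x1 n_gt0 /andP[q0 qp] npq x2.
have x_le1 := nneseries_eq1_le1 x0 x1.
have l20 : 0 < ln (2 : R) by rewrite ln_gt0// ltr1n.
pose H := (\sum_(0 <= i <oo) (- (x i * ln (x i)))%:E)%E.
have xln i : 0 <= - (x i * ln (x i)).
  by rewrite oppr_ge0 mulr_ge0_le0// ln_le0.
have -> : (\sum_(0 <= i <oo) (- xlog2 (x i))%:E = (ln 2)^-1%:E * H)%E.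
  rewrite -nneseriesZl//; last by move=> i _; rewrite lee_fin.
  by apply: eq_eseriesr => i _; rewrite xlog2E -EFinM -mulNr mulrC.
suff HH : ((- (n%:R * (p * ln p)) - q * ln q)%:E <= H)%E.
  have -> : - (n%:R * xlog2 p) - xlog2 q =
      (ln 2)^-1 * (- (n%:R * (p * ln p)) - q * ln q).
    by rewrite !xlog2E; ring.
  by rewrite EFinM lee_wpmul2l// lee_fin invr_ge0 ltW.
have := phi_series x0 x1 n_gt0 _ npq x2; rewrite q0 qp => /(_ isT).
have -> : (\sum_(0 <= i <oo) (phi (x i))%:E =
    2^-1%:E * (\sum_(0 <= i <oo) (x i ^+ 2)%:E) + H)%E.
  rewrite -nneseriesZl//; last by move=> i _; rewrite lee_fin sqr_ge0.
  rewrite -nneseriesD//; last 2 first.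
  - by move=> i _; rewrite -EFinM lee_fin mulr_ge0// sqr_ge0.
  - by move=> i _; rewrite lee_fin.
  by apply: eq_eseriesr => i _; rewrite -EFinM -EFinD /phi mulrC.
have h2 : (0 <= (2^-1)%:E :> \bar R)%E by rewrite lee_fin.
move=> /le_trans /(_ (leeD2r _ (lee_wpmul2l h2 x2))).
rewrite -EFinM -leeBlDl// -EFinB.
apply: le_trans; rewrite lee_fin /phi; lra.
Qed.

End Entropy.

(** * Tonelli's theorem on a measurable rectangle, by extension by zero *)

Section Tonelli.
Variable R : realType.
Local Notation mu := (@lebesgue_measure R).
Variables (A B : set R) (g : R * R -> \bar R).
Hypotheses (mA : measurable A) (mB : measurable B).
Hypotheses (mg : measurable_fun setT g) (g0 : forall z, (0 <= g z)%E).

Lemma measurable_fun_integral_section :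
  measurable_fun A (fun x => \int[mu]_(y in B) g (x, y))%E.
Proof.
apply: (@measurable_funS _ _ _ _ setT) => //.
pose h := g \_ (setT `*` B).
have mh : measurable_fun setT h.
  apply/(measurable_restrictT _ _).1; first exact: measurableX.
  exact: measurable_funS mg.
have h0 z : (0 <= h z)%E by apply: erestrict_ge0.
have := @measurable_fun_fubini_tonelli_F _ _ _ _ _ mu h mh h0.
apply: eq_measurable_fun => x _; rewrite /fubini_F [RHS]integral_mkcond.
apply: eq_integral => y _; rewrite /h !patchE.
by have -> : ((x, y) \in setT `*` B) = (y \in B) by rewrite in_setX in_setT.
Qed.

Lemma fubini_tonelli_set :
  (\int[mu]_(x in A) \int[mu]_(y in B) g (x, y) =
   \int[mu]_(y in B) \int[mu]_(x in A) g (x, y))%E.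
Proof.
pose h := g \_ (A `*` B).
have mh : measurable_fun setT h.
  apply/(measurable_restrictT _ _).1; first exact: measurableX.
  exact: measurable_funS mg.
have h0 z : (0 <= h z)%E by apply: erestrict_ge0.
have := @fubini_tonelli _ _ _ _ _ mu mu h mh h0.
have hE x y : h (x, y) = if (x \in A) && (y \in B) then g (x, y) else 0%E.
  by rewrite /h patchE in_setX.
move=> H; rewrite integral_mkcond [RHS]integral_mkcond.
apply: (etrans _ (etrans H _)); last apply: esym;
  apply: eq_integral => z _; rewrite patchE; case: ifPn => zA.
- rewrite integral_mkcond; apply: eq_integral => y _.
  by rewrite hE zA patchE.
- by apply/esym; apply: integral0_eq => y _; rewrite hE (negbTE zA).
- rewrite integral_mkcond; apply: eq_integral => y _.
  by rewrite hE zA andbT patchE.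
- by apply/esym; apply: integral0_eq => y _; rewrite hE (negbTE zA) andbF.
Qed.

End Tonelli.

(** * The distortion contributed by a single cell *)

Section CellDistortion.
Variable R : realType.
Local Notation mu := (@lebesgue_measure R).
Local Notation I01 := (`[0%R, 1%R]%classic : set R).

(** The function F_i of the overview. Leaving it unnormalised makes it 1-Lipschitz and keeps it
    meaningful on null cells. *)
Definition ccdf (C : set R) (t : R) : R := fine (mu (C `&` `]-oo, t])).

(* The path sawpath u exceeds the conditional mean t - G(t) by G(t) - 1(u <= t),
   where G = ccdf C / mu C is the conditional distribution function of U given C. *)
Definition cell_mean (C : set R) (t : R) : R :=
  Rintegral mu C (fun u => sawpath u t) / fine (mu C).

Variable (C : set R).
Hypotheses (mC : measurable C) (C01 : C `<=` I01).
Local Notation p := (fine (mu C)).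

Lemma measure_fin_subset (A : set R) : measurable A -> A `<=` I01 ->
  mu A \is a fin_num.
Proof.
move=> mA A01; rewrite ge0_fin_numE//.
have : (mu A <= mu I01)%E by apply: le_measure; rewrite ?inE.
move=> /le_lt_trans; apply.
by rewrite /= lebesgue_measure_itv/= lte_fin ltr01 -EFinB ltry.
Qed.

Let mCl t : measurable (C `&` `]-oo, t]). Proof. exact: measurableI. Qed.
Let mCr t : measurable (C `&` `]t, +oo[). Proof. exact: measurableI. Qed.

Lemma measure_cellE : mu C = p%:E.
Proof. by rewrite fineK// measure_fin_subset. Qed.

Lemma ccdfE t : mu (C `&` `]-oo, t]) = (ccdf C t)%:E.
Proof. by rewrite fineK// measure_fin_subset// => x [/C01]. Qed.

Lemma ccdf_compl t : mu (C `&` `]t, +oo[) = (p - ccdf C t)%:E.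
Proof.
have fr : mu (C `&` `]t, +oo[) \is a fin_num.
  by rewrite measure_fin_subset// => x [/C01].
have : mu C = (mu (C `&` `]-oo, t]) + mu (C `&` `]t, +oo[))%E.
  rewrite -measureU.
  - by rewrite -setIUr -itv_bndbnd_setU// set_itvE setIT.
  - exact: mCl.
  - exact: mCr.
  apply/seteqP; split => // x [[_ xt] [_ tx]].
  by move: xt tx; rewrite /= !in_itv/= andbT ltNge => ->.
move=> E; have -> : p = ccdf C t + fine (mu (C `&` `]t, +oo[)).
  by rewrite E ccdfE -[X in (_ + X)%E](fineK fr).
by rewrite addrC addKr fineK.
Qed.

Lemma ccdf_ge0 t : 0 <= ccdf C t.
Proof. by rewrite fine_ge0. Qed.

Lemma ccdf_le t : ccdf C t <= p.
Proof. by rewrite -subr_ge0 -lee_fin -ccdf_compl measure_ge0. Qed.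

Lemma ccdf_ndecr : {homo ccdf C : s t / s <= t}.
Proof.
move=> s t st; rewrite -lee_fin -!ccdfE.
apply: le_measure; rewrite ?inE; [exact: mCl|exact: mCl|].
apply: setIS => x /=; rewrite !in_itv/= => xs; exact: le_trans st.
Qed.

Lemma ccdf_lip s t : s <= t -> ccdf C t - ccdf C s <= t - s.
Proof.
move=> st; rewrite lerBlDr -lee_fin EFinD -!ccdfE.
have -> : (t - s)%:E = mu (`]s, t] : set R).
  rewrite /= lebesgue_measure_itv/= lte_fin; case: ltP => // ts.
  by have -> : t = s by [apply/eqP; rewrite eq_le ts st]; rewrite subrr.
apply: (@le_trans _ _ (mu (`]s, t] `|` (C `&` `]-oo, s])))); last first.
  by apply: measureU2; [exact: measurable_itv|exact: mCl].
apply: le_measure; rewrite ?inE; [exact: mCl|by apply: measurableU; [exact: measurable_itv|exact: mCl]|].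
move=> x [Cx]; rewrite /= !in_itv/= => xt.
by case: (lerP x s) => xs; [right|left; rewrite xt].
Qed.

Lemma ccdf_le0 t : t <= 0 -> ccdf C t = 0.
Proof.
move=> t0; apply/eqP; rewrite eq_le ccdf_ge0 andbT.
apply: le_trans (ccdf_ndecr t0) _.
rewrite -lee_fin -ccdfE (@le_trans _ _ (mu [set 0]))//; last first.
  by rewrite lebesgue_measure_set1.
apply: le_measure; rewrite ?inE; [exact: mCl|exact: measurable_set1|] => x [/C01] /=; rewrite !in_itv/= => /andP[x0 _] x1.
by apply/eqP; rewrite eq_le x0 x1.
Qed.

Lemma ccdf_ge1 t : 1 <= t -> ccdf C t = p.
Proof.
move=> t1; rewrite /ccdf (_ : C `&` _ = C)//; apply/setIidl.
by move=> x /C01 /=; rewrite !in_itv/= => /andP[_ x1]; exact: le_trans t1.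
Qed.

Lemma continuous_ccdf : continuous (ccdf C).
Proof.
move=> t; apply/cvgrPdist_le => e e0; near=> s.
have H u v : u <= v -> `|ccdf C v - ccdf C u| <= v - u.
  by move=> uv; rewrite ger0_norm ?subr_ge0 ?ccdf_ndecr// ccdf_lip.
apply: (@le_trans _ _ `|t - s|); last first.
  by near: s; apply: (@cvgr_dist_le _ _ _ _ _ id t) => //; exact: cvg_id.
case: (leP s t) => st; first by rewrite (le_trans (H _ _ st))// ger0_norm ?subr_ge0.
by rewrite distrC (le_trans (H _ _ (ltW st)))// ltr0_norm ?subr_lt0// opprB.
Unshelve. all: by end_near. Qed.

Lemma measurable_ccdf (D : set R) : measurable D -> measurable_fun D (ccdf C).
Proof. by move=> mD; apply: nondecreasing_measurable => // s t; exact: ccdf_ndecr. Qed.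

Lemma ccdf_median : exists2 t0, 0 <= t0 <= 1 & ccdf C t0 = p / 2.
Proof.
have p0 : 0 <= p by rewrite fine_ge0.
have [] := @IVT R (ccdf C) 0 1 (p / 2) ler01.
- by apply: continuous_subspaceT => x; exact: continuous_ccdf.
- have [p2 p2p] : 0 <= p / 2 /\ p / 2 <= p by split; lra.
  by rewrite (ccdf_le0 (lexx _)) (ccdf_ge1 (lexx _)) ge_min le_max p2 p2p orbT.
by move=> t0; rewrite in_itv/=; exists t0.
Qed.


Lemma Rintegral_sawpath t :
  Rintegral mu C (fun u => sawpath u t) = t * p - ccdf C t.
Proof.
have E : (\int[mu]_(u in C) (sawpath u t)%:E =
    \int[mu]_(u in C) (t%:E - (\1_(`]-oo, t]%classic : set R) u)%:E))%E.
  apply: eq_integral => u _; rewrite -EFinB; congr (_%:E).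
  rewrite /sawpath indicE; congr (t - _).
  rewrite (_ : (u \in _) = (u <= t)) ?mem_setE ?in_itv//.
  by case: (u <= t).
rewrite /Rintegral E integralB//; last 2 first.
- apply/integrableP; split; first exact: measurable_cst.
  by rewrite integral_cst//= measure_cellE -EFinM ltry.
- apply/integrableP; split.
    by apply/measurable_EFinP; exact: measurable_indic.
  under eq_integral do rewrite gee0_abs ?lee_fin//.
  by rewrite integral_indic//= setIC ccdfE ltry.
rewrite integral_cst//= measure_cellE integral_indic//= setIC ccdfE.
by rewrite -EFinM -EFinB.
Qed.

(** Given C, the path at time t takes the value t - 1 with probability F/p and t otherwise; the
    integral is p times the variance of this two-valued variable. *)
Lemma integral_cell_section t : p != 0 ->
  (\int[mu]_(u in C) ((sawpath u t - cell_mean C t) ^+ 2)%:E =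
    (ccdf C t * (p - ccdf C t) / p)%:E)%E.
Proof.
move=> p0; rewrite /cell_mean Rintegral_sawpath.
set F := ccdf C t; set m := (t * p - F) / p.
have mm (a : R) (D : set R) : measurable_fun D (fun u : R => ((sawpath u t - a) ^+ 2)%:E).
  apply: (@measurable_funS _ _ _ _ setT) => //.
  apply/measurable_EFinP; apply: measurable_funX; apply: measurable_funB => //.
  rewrite /sawpath; apply: measurable_funB => //.
  by apply: measurable_fun_ifT => //; exact: measurable_fun_ler.
have CE : C = (C `&` `]-oo, t]) `|` (C `&` `]t, +oo[).
  by rewrite -setIUr -itv_bndbnd_setU// set_itvE setIT.
rewrite [in LHS]CE ge0_integral_setU; first last.
- apply/disj_setPLR => x [_ xt] [_ tx].
  by move: xt tx; rewrite /= !in_itv/= andbT ltNge => ->.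
- by move=> u _; rewrite lee_fin sqr_ge0.
- exact: mm.
- exact: mCr.
- exact: mCl.
rewrite (eq_integral (fun=> ((t - 1 - m) ^+ 2)%:E)); last first.
  by move=> u; rewrite inE => -[_]; rewrite /= in_itv/= /sawpath => ->.
rewrite [X in (_ + X)%E](eq_integral (fun=> ((t - m) ^+ 2)%:E)); last first.
  move=> u; rewrite inE => -[_]; rewrite /= in_itv/= andbT /sawpath ltNge.
  by move=> /negbTE ->; rewrite subr0.
rewrite !integral_cst/=; [|exact: mCr|exact: mCl].
rewrite ccdfE ccdf_compl -!EFinM -EFinD; congr (_%:E).
by rewrite /m -/F; field.
Qed.

Lemma measurable_saw_sq (m : R -> R) : measurable_fun setT m ->
  measurable_fun setT (fun z : R * R => ((sawpath z.1 z.2 - m z.2) ^+ 2)%:E).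
Proof.
move=> mm; apply/measurable_EFinP; apply: measurable_funX; apply: measurable_funB.
  rewrite /sawpath; apply: measurable_funB => //.
  by apply: measurable_fun_ifT => //; exact: measurable_fun_ler.
exact: measurableT_comp.
Qed.

Lemma measurable_cell_mean : measurable_fun setT (cell_mean C).
Proof.
rewrite (_ : cell_mean C = fun t => (t * p - ccdf C t) / p); last first.
  by apply/funext => t; rewrite /cell_mean Rintegral_sawpath.
apply: measurable_funM => //; apply: measurable_funB; last exact: measurable_ccdf.
exact: measurable_funM.
Qed.

Lemma measurable_cell_error :
  measurable_fun C (fun u => \int[mu]_(t in I01) ((sawpath u t - cell_mean C t) ^+ 2)%:E)%E.
Proof.
pose g (z : R * R) := ((sawpath z.1 z.2 - cell_mean C z.2) ^+ 2)%:E.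
have mg : measurable_fun setT g := measurable_saw_sq measurable_cell_mean.
have g0 z : (0 <= g z)%E by rewrite lee_fin sqr_ge0.
exact: (@measurable_fun_integral_section _ C I01 g).
Qed.

Lemma integral_cell_error :
  (\int[mu]_(u in C) \int[mu]_(t in I01) ((sawpath u t - cell_mean C t) ^+ 2)%:E =
   \int[mu]_(t in I01) (ccdf C t * (p - ccdf C t) / p)%:E)%E.
Proof.
(* On a null cell both sides vanish, the right one because the inverse of 0 is 0. *)
have [p0|p0] := eqVneq p 0.
  rewrite null_set_integral//; last 2 first.
  - exact: measurable_cell_error.
  - by rewrite /= measure_cellE p0.
  by rewrite integral0_eq// => t _; rewrite p0 invr0 mulr0.
pose g (z : R * R) := ((sawpath z.1 z.2 - cell_mean C z.2) ^+ 2)%:E.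
have mg : measurable_fun setT g := measurable_saw_sq measurable_cell_mean.
have g0 z : (0 <= g z)%E by rewrite lee_fin sqr_ge0.
rewrite (@fubini_tonelli_set _ C I01 g)//.
by apply: eq_integral => t _; exact: integral_cell_section.
Qed.

Lemma measurable_ccdf_var (D : set R) (a : R) : measurable D ->
  measurable_fun D (fun t => (ccdf C t * (p - ccdf C t) / a)%:E).
Proof.
move=> mD; apply/measurable_EFinP; apply: measurable_funM => //.
have mF := measurable_ccdf mD.
by apply: measurable_funM => //; exact: measurable_funB.
Qed.

Lemma integral_parabola (t0 h a : R) : 0 <= h ->
  (\int[mu]_(t in `[(t0 - h)%R, (t0 + h)%R]) ((h ^+ 2 - (t - t0) ^+ 2) / a)%:E =
    (4 / 3 * h ^+ 3 / a)%:E)%E.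
Proof.
move=> h0; have lh : t0 - h <= t0 + h by lra.
pose P (t : R) : R := (h ^+ 2 * t - (t - t0) ^+ 3 / 3) / a.
apply: etrans (@integral_derive R P _ _ _ lh _ _) _.
- move=> t _; rewrite /P; apply: is_derive_eq.
  (* Since a may be 0, its inverse is made opaque so that [field] does not ask for a != 0. *)
  by rewrite /= /GRing.scale/=; set b := a^-1; field.
- move=> t _; apply: continuousM; last exact: cst_continuous.
  apply: continuousB; first exact: cst_continuous.
  apply: (@continuous_comp _ _ _ (fun t => t - t0) (fun t => t ^+ 2)).
    by apply: continuousB; [exact: cvg_id|exact: cst_continuous].
  exact: exprn_continuous.
- by congr (_%:E); rewrite /P; set b := a^-1; field.
Qed.

(* F is 1-Lipschitz and equals p/2 at its median t0, so
   F (p - F) = p^2/4 - (F - p/2)^2 >= p^2/4 - (t - t0)^2. *)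
Lemma integral_ccdf_var_ge :
  ((p ^+ 2 / 6)%:E <= \int[mu]_(t in I01) (ccdf C t * (p - ccdf C t) / p)%:E)%E.
Proof.
have p0 : 0 <= p by rewrite fine_ge0.
have var0 t : (0 <= (ccdf C t * (p - ccdf C t) / p)%:E)%E.
  by rewrite lee_fin divr_ge0// mulr_ge0 ?ccdf_ge0// subr_ge0 ccdf_le.
have [t0 /andP[t00 t01] Ft0] := ccdf_median.
have h0 : 0 <= p / 2 by lra.
(* Climbing from 0 to p/2 and from p/2 to p takes at least p/2 units of time each, so the whole
   interval of radius p/2 around the median lies in [0, 1]. *)
have lo : 0 <= t0 - p / 2.
  by have := ccdf_lip t00; rewrite (ccdf_le0 (lexx 0)) Ft0; lra.
have hi : t0 + p / 2 <= 1.
  by have := ccdf_lip t01; rewrite (ccdf_ge1 (lexx 1)) Ft0; lra.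
apply: (@le_trans _ _ (\int[mu]_(t in `[(t0 - p / 2)%R, (t0 + p / 2)%R])
    (ccdf C t * (p - ccdf C t) / p)%:E)%E); last first.
  apply: ge0_subset_integral => //; first exact: measurable_ccdf_var.
  move=> t /=; rewrite !in_itv/= => /andP[a b].
  by rewrite (le_trans lo a) (le_trans b hi).
have -> : p ^+ 2 / 6 = 4 / 3 * (p / 2) ^+ 3 / p.
  have [->|pn0] := eqVneq p 0; first by rewrite invr0 mulr0 expr0n/= mul0r.
  by field.
rewrite -(integral_parabola t0 p h0); apply: ge0_le_integral => //.
- move=> t /=; rewrite in_itv/= => /andP[a b].
  by rewrite lee_fin divr_ge0//; nra.
- apply/measurable_EFinP; apply: measurable_funM => //.
  apply: measurable_funB => //; apply: measurable_funX.
  exact: measurable_funB.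
- exact: measurable_ccdf_var.
move=> t _; rewrite lee_fin ler_wpM2r ?invr_ge0//.
have : (ccdf C t - p / 2) ^+ 2 <= (t - t0) ^+ 2; last by nra.
rewrite -Ft0; case: (leP t0 t) => tt.
  by have := ccdf_lip tt; have := ccdf_ndecr tt; nra.
by have := ccdf_lip (ltW tt); have := ccdf_ndecr (ltW tt); nra.
Qed.

(** The bounds F <= t - a and p - F <= b - t add up to b - a = p, so both are equalities on [a, b],
    and F (p - F) is exactly the parabola. Asking only for inclusion in [a, b] covers half-open and
    empty cells as well. *)
Lemma integral_ccdf_var_itv (a b : R) : 0 <= a -> b <= 1 -> b = a + p ->
  C `<=` `[a, b] ->
  (\int[mu]_(t in I01) (ccdf C t * (p - ccdf C t) / p)%:E = (p ^+ 2 / 6)%:E)%E.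
Proof.
move=> a0 b1 bE Cab; have p0 : 0 <= p by rewrite fine_ge0.
have h0 : 0 <= p / 2 by lra.
have mitv (u v : R) (x y : bool) : u <= v ->
    mu ([set` Interval (BSide x u) (BSide y v)] : set R) = (v - u)%:E.
  move=> uv; rewrite /= lebesgue_measure_itv/= lte_fin -EFinB; case: ltP => // vu.
  by have -> : u = v by [apply/eqP; rewrite eq_le uv vu]; rewrite subrr.
have Fup t : a <= t -> ccdf C t <= t - a.
  move=> at_; rewrite -lee_fin -ccdfE -(mitv _ _ true false at_).
  apply: le_measure; rewrite ?inE; [exact: mCl|exact: measurable_itv|].
  by move=> x [/Cab]; rewrite /= !in_itv/= => /andP[-> _].
have Flo t : t <= b -> p - ccdf C t <= b - t.
  move=> tb; rewrite -lee_fin -ccdf_compl -(mitv _ _ false false tb).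
  apply: le_measure; rewrite ?inE; [exact: mCr|exact: measurable_itv|].
  by move=> x [/Cab]; rewrite /= !in_itv/= andbT => /andP[_ ->] ->.
pose par (t : R) : R := ((p / 2) ^+ 2 - (t - (a + p / 2)) ^+ 2) / p.
transitivity (\int[mu]_(t in I01) ((EFin \o par) \_ (`[a, b]%classic : set R)) t)%E.
  apply: eq_integral => t _; rewrite patchE.
  have -> : (t \in (`[a, b]%classic : set R)) = (a <= t <= b).
    by rewrite mem_setE in_itv.
  case: ifPn.
    move=> /andP[at_ tb]; have F1 := Fup _ at_; have F2 := Flo _ tb.
    have -> : ccdf C t = t - a by lra.
    by congr (_%:E); congr (_ / p); lra.
  rewrite negb_and -!ltNge => /orP[ta|bt].
    have -> : ccdf C t = 0; last by rewrite !mul0r.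
    apply/eqP; rewrite eq_le ccdf_ge0 andbT (le_trans (ccdf_ndecr (ltW ta)))//.
    by have := Fup _ (lexx a); lra.
  have -> : ccdf C t = p; last by rewrite subrr mulr0 mul0r.
  apply/eqP; rewrite eq_le ccdf_le/= (le_trans _ (ccdf_ndecr (ltW bt)))//.
  by have := Flo _ (lexx b); lra.
rewrite -integral_mkcondr setIidr; last first.
  move=> t /=; rewrite !in_itv/= => /andP[at_ tb].
  by rewrite (le_trans a0 at_) (le_trans tb b1).
have := integral_parabola (a + p / 2) p h0.
have -> : a + p / 2 - p / 2 = a by lra.
have -> : a + p / 2 + p / 2 = b by lra.
rewrite /par => ->; congr (_%:E).
have [->|pn0] := eqVneq p 0; first by rewrite invr0 mulr0 expr0n/= mul0r.
by field.
Qed.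

End CellDistortion.

(** * Encoders: reduction to cell probabilities *)

Section Encoders.
Variable R : realType.
Local Notation mu := (@lebesgue_measure R).
Local Notation I01 := (`[0%R, 1%R]%classic : set R).
Implicit Types f : (R -> R) -> nat.

Lemma cell_sub01 f i : cell f i `<=` I01.
Proof. by move=> u []. Qed.

Lemma bigcup_cell f : \bigcup_i cell f i = I01.
Proof.
apply/seteqP; split => [u [i _ []]//|u u01].
by exists (f (sawpath u)).
Qed.

Lemma trivIset_cell f : trivIset setT (cell f).
Proof. by move=> i j _ _ [u [[_ /= <-] [_ /= <-]]]. Qed.

Lemma cellprob_ge0 f i : 0 <= cellprob f i.
Proof. by rewrite fine_ge0. Qed.

Lemma nneseries_cellprob f : encoder f ->
  (\sum_(0 <= i <oo) (cellprob f i)%:E = 1)%E.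
Proof.
move=> ef; transitivity (mu (\bigcup_i cell f i)).
  rewrite measure_semi_bigcup//=; last 2 first.
  - exact: trivIset_cell.
  - by rewrite bigcup_cell.
  by apply: eq_eseriesr => i _; rewrite -(measure_cellE (ef i) (@cell_sub01 f i)).
by rewrite bigcup_cell lebesgue_measure_itv/= lte_fin ltr01 -EFinB subr0.
Qed.

Lemma cellprob_le1 f : encoder f -> forall i, cellprob f i <= 1.
Proof.
by move=> ef; apply: nneseries_eq1_le1 (nneseries_cellprob ef); exact: cellprob_ge0.
Qed.

Lemma distortionE f : encoder f ->
  (distortion f = \sum_(0 <= i <oo) \int[mu]_(t in I01)
    (ccdf (cell f i) t * (cellprob f i - ccdf (cell f i) t) / cellprob f i)%:E)%E.
Proof.
move=> ef; rewrite /distortion.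
have ge0 u : (0 <= \int[mu]_(t in I01)
    ((sawpath u t - condmean f (f (sawpath u)) t) ^+ 2)%:E)%E.
  by apply: integral_ge0 => t _; rewrite lee_fin sqr_ge0.
have cellE i u : cell f i u -> f (sawpath u) = i by case.
have mi i : measurable_fun (cell f i) (fun u => \int[mu]_(t in I01)
    ((sawpath u t - condmean f (f (sawpath u)) t) ^+ 2)%:E)%E.
  have := measurable_cell_error (ef i) (@cell_sub01 f i).
  by apply: eq_measurable_fun => u; rewrite inE => /cellE ->.
rewrite -{1}(bigcup_cell f) ge0_integral_bigcup//; last 2 first.
- exact/measurable_fun_bigcup.
- exact: trivIset_cell.
apply: eq_eseriesr => i _.
rewrite -(integral_cell_error (ef i) (@cell_sub01 f i)).
by apply: eq_integral => u; rewrite inE => /cellE ->.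
Qed.

Lemma distortion_ge f (D : R) : encoder f -> (distortion f <= D%:E)%E ->
  (\sum_(0 <= i <oo) (cellprob f i ^+ 2)%:E <= (6 * D)%:E)%E.
Proof.
move=> ef; rewrite distortionE// => fD.
have -> : (\sum_(0 <= i <oo) (cellprob f i ^+ 2)%:E =
    6%:E * \sum_(0 <= i <oo) (cellprob f i ^+ 2 / 6)%:E)%E.
  rewrite -nneseriesZl//.
    by apply: eq_eseriesr => i _; rewrite -EFinM; congr (_%:E); field.
  by move=> i _; rewrite lee_fin divr_ge0// sqr_ge0.
rewrite EFinM lee_wpmul2l ?lee_fin//; apply: le_trans fD.
apply: lee_nneseries => i _; first by rewrite lee_fin divr_ge0// sqr_ge0.
exact: integral_ccdf_var_ge (ef i) (@cell_sub01 f i).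
Qed.

Lemma entropy_ge0 f : encoder f -> (0 <= entropy f)%E.
Proof.
move=> ef; apply: nneseries_ge0 => i _ _; rewrite lee_fin oppr_ge0 xlog2_le0//.
by rewrite cellprob_ge0 cellprob_le1.
Qed.

(** For u < v the paths differ at time u, where only the first has jumped. Hence an encoder may be
    prescribed as a function of u. *)
Lemma sawpath_inj : injective (@sawpath R).
Proof.
suff H (u v : R) : u < v -> sawpath u <> sawpath v.
  by move=> u v uv; case: (ltgtP u v) => // /H; rewrite uv.
move=> uv /(congr1 (fun g => g u)); rewrite /sawpath lexx leNgt uv/=; lra.
Qed.

(* xget recovers u from the path g = sawpath u; on other paths it yields 0. *)
Definition floor_code (p : R) (g : R -> R) : nat :=
  Num.truncn (xget 0 [set u | sawpath u = g] / p).

Lemma floor_codeE p u : floor_code p (sawpath u) = Num.truncn (u / p).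
Proof.
rewrite /floor_code; congr (Num.truncn (_ / p)).
by apply: xget_unique => // v /sawpath_inj.
Qed.

(** * The interval encoder: n cells of length p and a last one of length q *)

Section FloorCode.
Variables (p : R) (p0 : 0 < p) (p1 : p <= 1).
Let n := Num.truncn p^-1.
Let q : R := 1 - n%:R * p.

Lemma truncn_inv_bounds : n%:R * p <= 1 /\ 1 < n.+1%:R * p.
Proof.
have /andP[h1 h2] : n%:R <= p^-1 < n.+1%:R.
  by apply: truncn_itv; rewrite invr_ge0 ltW.
by rewrite -ler_pdivlMr// -ltr_pdivrMr// div1r.
Qed.

Lemma cell_floor_code i : cell (floor_code p) i =
  I01 `&` `[i%:R * p, i.+1%:R * p[.
Proof.
apply/seteqP; split => u [u01]; split => //; move: u01 b;
  rewrite /= !in_itv/= floor_codeE => /andP[u0 u1].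
  have up : 0 <= u / p by rewrite divr_ge0// ltW.
  by move/eqP; rewrite truncn_eq// ler_pdivlMr// ltr_pdivrMr.
have up : 0 <= u / p by rewrite divr_ge0// ltW.
by move=> H; apply/eqP; rewrite truncn_eq// ler_pdivlMr// ltr_pdivrMr.
Qed.

Lemma floor_code_encoder : encoder (floor_code p).
Proof.
move=> i; rewrite -/(cell _ i) cell_floor_code.
by apply: measurableI.
Qed.

Lemma cell_floor_code_lt i : (i < n)%N ->
  cell (floor_code p) i = `[i%:R * p, i.+1%:R * p[%classic.
Proof.
move=> lt_in; rewrite cell_floor_code; apply/setIidr => u /=.
have [np _] := truncn_inv_bounds.
have : i.+1%:R * p <= n%:R * p by rewrite ler_wpM2r ?ler_nat// ltW.
have : 0 <= i%:R * p by rewrite mulr_ge0// ltW.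
rewrite !in_itv/= => ? ? /andP[? ?]; apply/andP; split; lra.
Qed.

(** The endpoint 1 always falls in cell n; when n p = 1 this cell is the null set {1} and q = 0. *)
Lemma cell_floor_code_eq : cell (floor_code p) n = `[n%:R * p, 1]%classic.
Proof.
rewrite cell_floor_code; have [np np1] := truncn_inv_bounds.
have n0 : 0 <= n%:R * p by rewrite mulr_ge0// ltW.
apply/seteqP; split => u /=; rewrite !in_itv/=.
  by move=> [/andP[_ ->] /andP[-> _]].
by move=> /andP[a b]; split; apply/andP; split => //; lra.
Qed.

Lemma cell_floor_code_gt i : (n < i)%N -> cell (floor_code p) i = set0.
Proof.
move=> ni; rewrite cell_floor_code -subset0 => u [] /=.
have [_ np1] := truncn_inv_bounds.
have : n.+1%:R * p <= i%:R * p by rewrite ler_wpM2r ?ler_nat// ltW.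
rewrite !in_itv/= => ? /andP[? ?] /andP[? ?]; lra.
Qed.

Lemma cellprob_floor_code i : cellprob (floor_code p) i =
  if (i < n)%N then p else if i == n then q else 0.
Proof.
have [np _] := truncn_inv_bounds.
rewrite /cellprob; case: ltngtP => [lt_in|ni|->].
- rewrite cell_floor_code_lt//= lebesgue_measure_itv/= lte_fin ltr_pM2r// ltr_nat.
  by rewrite ltnSn -EFinB/= -mulrBl -natrB// subSnn mul1r.
- by rewrite cell_floor_code_gt// measure0.
rewrite cell_floor_code_eq//= lebesgue_measure_itv/= lte_fin /q.
case: ltP => // np1; rewrite -?EFinB//=.
by apply/eqP; rewrite eq_sym subr_eq0 eq_le np np1.
Qed.

(** Serves both the entropy, with - [xlog2], and the distortion, with x^2/6. *)
Lemma nneseries_floor_code (psi : R -> R) :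
  psi 0 = 0 -> 0 <= psi p -> 0 <= psi q ->
  (\sum_(0 <= i <oo) (psi (cellprob (floor_code p) i))%:E =
    (n%:R * psi p + psi q)%:E)%E.
Proof.
move=> psi0 psip psiq.
rewrite (nneseries_split 0%N n.+1); last first.
  by move=> i _; rewrite lee_fin cellprob_floor_code; case: ifP => // _; case: ifP; rewrite ?psi0.
rewrite eseries0 ?adde0; last first.
  move=> i; rewrite add0n => ni _; rewrite cellprob_floor_code.
  by rewrite ltnNge (ltnW ni)/= gtn_eqF// psi0.
rewrite add0n sumEFin big_nat_recr//= cellprob_floor_code ltnn eqxx.
congr (_ + _)%:E; rewrite big_mkord (eq_bigr (fun=> psi p)).
  by rewrite sumr_const card_ord mulr_natl.
by move=> i _; rewrite cellprob_floor_code ltn_ord.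
Qed.

Lemma entropy_floor_code :
  entropy (floor_code p) = (- (n%:R * xlog2 p) - xlog2 q)%:E.
Proof.
have [np np1] := truncn_inv_bounds.
have n0 : 0 <= n%:R * p by rewrite mulr_ge0// ltW.
rewrite /entropy (@nneseries_floor_code (fun x => - xlog2 x)) ?mulrN//.
- by rewrite xlog2E !mul0r oppr0.
- by rewrite oppr_ge0 xlog2_le0// (ltW p0).
- by rewrite oppr_ge0 xlog2_le0// /q; apply/andP; split; lra.
Qed.

Lemma distortion_floor_code :
  distortion (floor_code p) = ((n%:R * p ^+ 2 + q ^+ 2) / 6)%:E.
Proof.
have [np np1] := truncn_inv_bounds.
rewrite distortionE; last exact: floor_code_encoder.
rewrite mulrDl -mulrA -(@nneseries_floor_code (fun x => x ^+ 2 / 6)); last 3 first.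
- by rewrite expr0n/= mul0r.
- by rewrite divr_ge0// sqr_ge0.
- by rewrite divr_ge0// sqr_ge0.
apply: eq_eseriesr => i _.
have main (a b : R) : 0 <= a -> b <= 1 -> b = a + cellprob (floor_code p) i ->
    cell (floor_code p) i `<=` `[a, b] -> _ :=
  @integral_ccdf_var_itv R _ (floor_code_encoder i) (@cell_sub01 _ i) a b.
have ip0 : 0 <= i%:R * p by rewrite mulr_ge0// ltW.
case: (ltngtP i n) => [lt_in|ni|ein].
- apply: (main (i%:R * p) (i.+1%:R * p)) => //.
  + by rewrite (le_trans _ np)// ler_wpM2r ?ler_nat// ltW.
  + by rewrite cellprob_floor_code lt_in -natr1 mulrDl mul1r.
  + by rewrite cell_floor_code_lt// => u; rewrite /= !in_itv/= => /andP[-> /ltW].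
(* An empty cell counts as contained in the degenerate interval [0, 0]. *)
- apply: (main 0 0) => //.
  + by rewrite cellprob_floor_code ltnNge (ltnW ni)/= gtn_eqF// addr0.
  + by rewrite cell_floor_code_gt.
- apply: (main (i%:R * p) 1) => //.
  + by rewrite cellprob_floor_code ein ltnn eqxx /q addrC subrK.
  + by rewrite ein cell_floor_code_eq.
Qed.

End FloorCode.

End Encoders.

(** * Existence and uniqueness of p *)

Section Collision.
Variable R : realType.
Implicit Types p s : R.

Lemma floor_truncn (x : R) : 0 <= x -> (Num.floor x)%:~R = (Num.truncn x)%:R :> R.
Proof. by move=> x0; rewrite truncn_floor x0 natr_absz ger0_norm ?floor_ge0. Qed.

Lemma truncn_inv_eq (x : R) (n : nat) :
  0 < x -> n%:R * x <= 1 -> 1 < n.+1%:R * x -> Num.truncn x^-1 = n.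
Proof.
move=> x0 h1 h2; apply: truncn_def.
by rewrite -[x^-1]div1r ler_pdivlMr// ltr_pdivrMr// h1 h2.
Qed.

Lemma truncn_inv_gt0 p : 0 < p <= 1 -> (0 < Num.truncn p^-1)%N.
Proof. by move=> /andP[p0 p1]; rewrite truncn_gt0 invf_ge1. Qed.

(** The probability that two independent draws from (p, ..., p, 1 - n p) coincide. *)
Definition collision (n : nat) p : R := n%:R * p ^+ 2 + (1 - n%:R * p) ^+ 2.

(** Completing the square at the uniform distribution p = 1/(n+1). For p > 1/(n+1) this makes the
    collision probability strictly increasing and invertible by a square root. *)
Lemma collisionE n p :
  n.+1%:R * collision n p - 1 = n%:R * (n.+1%:R * p - 1) ^+ 2.
Proof. by rewrite /collision -natr1; ring. Qed.

(** The collision probability s lies in (1/(n+1), 1/n], like p itself, so the value 6 D alone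
    determines n. *)
Lemma truncn_inv_collision p : 0 < p <= 1 ->
  Num.truncn (collision (Num.truncn p^-1) p)^-1 = Num.truncn p^-1.
Proof.
move=> p01; have n0 := truncn_inv_gt0 p01; case/andP: p01 => p0 p1.
have [] := truncn_inv_bounds p0.
move: (Num.truncn p^-1) n0 => n n0 np np1.
have n1 : 1 <= n%:R :> R by rewrite (ler_nat _ 1).
have E := collisionE n p.
have pos : 0 < n%:R * (n.+1%:R * p - 1) ^+ 2.
  by rewrite mulr_gt0 ?exprn_gt0 ?subr_gt0// ltr0n.
apply: truncn_inv_eq.
- by rewrite ltr_wpDr ?sqr_ge0// mulr_gt0 ?exprn_gt0 ?ltr0n.
- rewrite -natr1 in np1.
  (* With q = 1 - n p, the product q (2 - (n+1) q) equals 1 - n s; it is nonnegative since (n+1) q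
     <= 1. *)
  have : 0 <= (1 - n%:R * p) * (2 - (n%:R + 1) * (1 - n%:R * p)).
    have : 0 <= n%:R * ((n%:R + 1) * p - 1) by apply: mulr_ge0 => //; lra.
    by move=> h; apply: mulr_ge0; lra.
  by rewrite /collision; nra.
- lra.
Qed.

Lemma collision_inj n p p' : (0 < n)%N ->
  1 < n.+1%:R * p -> 1 < n.+1%:R * p' -> collision n p = collision n p' -> p = p'.
Proof.
move=> n0 hp hp' E.
have := collisionE n p; rewrite E (collisionE n p').
have nn0 : n%:R != 0 :> R by rewrite pnatr_eq0 -lt0n.
move=> /(mulfI nn0) /eqP; rewrite eqrXn2 ?subr_ge0 ?ltW// => /eqP h.
have nS0 : n.+1%:R != 0 :> R by rewrite pnatr_eq0.
by apply: (mulfI nS0); lra.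
Qed.

Lemma collision_surj s : 0 < s < 1 ->
  exists2 p, 0 < p < 1 & collision (Num.truncn p^-1) p = s.
Proof.
move=> /andP[s0 s1].
have n0 : (0 < Num.truncn s^-1)%N by rewrite truncn_inv_gt0// s0 ltW.
have [] := truncn_inv_bounds s0.
move: (Num.truncn s^-1) n0 => n n0 ns ns1.
have n1 : 1 <= n%:R :> R by rewrite (ler_nat _ 1).
(* By [collisionE], w = (n+1) p - 1 must satisfy n w^2 = (n+1) s - 1. The bound n w <= 1, which
   amounts to n p <= 1, comes from n s <= 1. *)
pose v : R := (n.+1%:R * s - 1) / n%:R.
have nv : n%:R * v = n.+1%:R * s - 1 by rewrite /v mulrC mulfVK//; lra.
have v0 : 0 < v by rewrite divr_gt0 ?subr_gt0// ltr0n.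
pose w := Num.sqrt v.
have w0 : 0 < w by rewrite sqrtr_gt0.
have w2 : w ^+ 2 = v by rewrite sqr_sqrtr// ltW.
rewrite -natr1 in nv ns1.
have w1 : w < 1.
  rewrite ltNge; apply/negP => w1; nra.
have nw : n%:R * w <= 1.
  rewrite leNgt; apply/negP => nw1; nra.
pose p := (1 + w) / n.+1%:R.
have nS0 : 0 < n.+1%:R :> R by [].
have np : n.+1%:R * p = 1 + w by rewrite /p mulrC mulfVK// gt_eqF.
have p0 : 0 < p by rewrite divr_gt0//; lra.
have tp : Num.truncn p^-1 = n.
  apply: truncn_inv_eq => //; last by rewrite np; lra.
  by rewrite -natr1 in np; nra.
exists p; first by rewrite p0/=; rewrite -natr1 in np; nra.
have := collisionE n p; rewrite tp np => E.
have : n.+1%:R * collision n p = n.+1%:R * s.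
  by rewrite -natr1 in E *; nra.
by move/(mulfI (lt0r_neq0 nS0)).
Qed.

End Collision.

Theorem theorem2 (R : realType) :
  (forall D : R, 6^-1 <= D -> entropy_distortion D = 0%E) /\
  (forall D : R, 0 < D < 6^-1 ->
     exists p : R,
       [/\ 0 < p < 1,
           (Num.floor p^-1)%:~R * p ^+ 2 + (1 - (Num.floor p^-1)%:~R * p) ^+ 2 = 6 * D,
           (forall p' : R, 0 < p' < 1 ->
              (Num.floor p'^-1)%:~R * p' ^+ 2 + (1 - (Num.floor p'^-1)%:~R * p') ^+ 2
                = 6 * D -> p' = p) &
           entropy_distortion D =
             (- ((Num.floor p^-1)%:~R * xlog2 p)
              - xlog2 (1 - (Num.floor p^-1)%:~R * p))%:E]).
Proof.
split=> D.
  move=> D6; apply/eqP; rewrite eq_le; apply/andP; split; last first.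
    by apply: le_ereal_inf_tmp => _ [f [ef _] <-]; exact: entropy_ge0.
  (* With p = 1 the cells are [0, 1[ and the null set {1}: the code is almost surely constant and
     has distortion 1/6. *)
  apply: ereal_inf_lbound; exists (floor_code 1); first split.
  - exact: floor_code_encoder.
  - rewrite distortion_floor_code// invr1 truncn1 lee_fin.
    by rewrite (le_trans _ D6)// mulr1 subrr expr1n expr0n/= addr0 mulr1 mul1r.
  - rewrite entropy_floor_code// invr1 truncn1 mulr1 subrr !xlog2E ln1.
    by rewrite !(mulr0, mul0r) oppr0 addr0.
move=> /andP[D0 D6].
have [p p01 pD] : exists2 p : R, 0 < p < 1 & collision (Num.truncn p^-1) p = 6 * D.
  by apply: collision_surj; lra.
have floorE (x : R) : 0 < x < 1 ->
    (Num.floor x^-1)%:~R = (Num.truncn x^-1)%:R :> R.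
  by move=> /andP[x0 _]; rewrite floor_truncn// invr_ge0 ltW.
have half (x : R) : 0 < x < 1 -> 0 < x <= 1 by lra.
have /andP[p0 p1] := half _ p01.
have [np np1] := truncn_inv_bounds p0.
have n0 := truncn_inv_gt0 (half _ p01).
exists p; rewrite (floorE p p01); split => //.
  move=> p' p'01; rewrite (floorE p' p'01) -/(collision _ _) => p'D.
  (* Both p and p' have the same floor of the inverse, that of 1/(6 D), so injectivity for this
     fixed n applies. *)
  have e := truncn_inv_collision (half _ p01); rewrite pD in e.
  have e' := truncn_inv_collision (half _ p'01); rewrite p'D in e'.
  have /andP[p'0 _] := p'01; have [_ np'1] := truncn_inv_bounds p'0.
  rewrite -e' e in p'D np'1.
  by apply: collision_inj n0 np'1 np1 _; rewrite p'D pD.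
apply/eqP; rewrite eq_le; apply/andP; split.
  apply: ereal_inf_lbound; exists (floor_code p); first split.
  - exact: floor_code_encoder.
  - rewrite distortion_floor_code// lee_fin.
    by move: pD; rewrite /collision => ->; lra.
  - exact: entropy_floor_code.
(* Converse: the cell probabilities of any admissible encoder sum to 1, with sum of squares at most
   6 D. *)
apply: le_ereal_inf_tmp => _ [f [ef fD] <-].
apply: nneseries_xlog2_ge => //.
- exact: cellprob_ge0.
- exact: nneseries_cellprob.
- by rewrite -natr1 in np1; lra.
- by ring.
- by have := distortion_ge ef fD; rewrite -pD.
Qed.
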